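(* Let $n$ be a positive integer. (i) For the initial data $y_0(x)=\sin nx$, $y_1(x)\equiv0$ on $[0,2\pi]$, there do not exist $T>0$ and a boundary control $\widetilde h\in C^1[0,T]$ such that the control system $$y_{tt}-y_{xx}=0,\quad y(t,0)=y(t,2\pi),\quad y_x(t,0)=y_x(t,2\pi)+\widetilde h(t),\quad y(0,x)=y_0(x),\ y_t(0,x)=y_1(x),\ x\in[0,2\pi]$$ has a $C^2$ solution $y=y(t,x)$ on $[0,T]\times[0,2\pi]$ satisfying exactly the final null condition $y(T,x)\equiv y_t(T,x)\equiv0$, $x\in[0,2\pi]$. (ii) For the initial data $y_0(x)\equiv0$, $y_1(x)=\cos nx$ on $[0,2\pi]$, there do not exist $T>0$ and a boundary control $h\in C^2[0,T]$ such that the control system $$y_{tt}-y_{xx}=0,\quad y(t,0)=y(t,2\pi)+h(t),\quad y_x(t,0)=y_x(t,2\pi),\quad y(0,x)=y_0(x),\ y_t(0,x)=y_1(x),\ x\in[0,2\pi]$$ has a $C^2$ solution $y=y(t,x)$ on $[0,T]\times[0,2\pi]$ satisfying exactly the final null condition $y(T,x)\equiv y_t(T,x)\equiv0$, $x\in[0,2\pi]$. *)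

(* Defs.v *)
From Stdlib Require Import Reals.
From Coquelicot Require Import Coquelicot.
Open Scope R_scope.

Definition interval (a b : R) : R -> Prop := fun s => a <= s <= b.

(* [D_in f f' D s] is differentiability relative to [D]: derivatives at the end
   points of a closed interval are one-sided, and the values of [f] outside the
   interval play no role. *)
Definition deriv_on (D : R -> Prop) (f f' : R -> R) : Prop :=
  forall s, D s -> D_in f f' D s.

Fixpoint Ck_on (k : nat) (D : R -> Prop) (f : R -> R) : Prop :=
  match k with
  | O => continuous_on D f
  | S j => continuous_on D f /\ exists f', deriv_on D f f' /\ Ck_on j D f'
  end.

Definition rect (T : R) (t x : R) : Prop :=
  interval 0 T t /\ interval 0 (2 * PI) x.

Definition cont_rect (T : R) (f : R -> R -> R) : Prop :=
  continuous_on (fun p : R * R => rect T (fst p) (snd p))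
                (fun p : R * R => f (fst p) (snd p)).

Definition partial_t (T : R) (f ft : R -> R -> R) : Prop :=
  forall x, interval 0 (2 * PI) x ->
    deriv_on (interval 0 T) (fun t => f t x) (fun t => ft t x).

Definition partial_x (T : R) (f fx : R -> R -> R) : Prop :=
  forall t, interval 0 T t ->
    deriv_on (interval 0 (2 * PI)) (fun x => f t x) (fun x => fx t x).

(* [y] is C^2 on [0,T] x [0,2 PI] and its partial derivatives up to order two
   are the given functions, [ytx] being the x-derivative of [yt] and [yxt] the
   t-derivative of [yx]. For 0 < T they are unique on the rectangle. *)
Record C2_rect (T : R) (y yt yx ytt ytx yxt yxx : R -> R -> R) : Prop := {
  C2_y : cont_rect T y;
  C2_yt : partial_t T y yt /\ cont_rect T yt;
  C2_yx : partial_x T y yx /\ cont_rect T yx;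
  C2_ytt : partial_t T yt ytt /\ cont_rect T ytt;
  C2_ytx : partial_x T yt ytx /\ cont_rect T ytx;
  C2_yxt : partial_t T yx yxt /\ cont_rect T yxt;
  C2_yxx : partial_x T yx yxx /\ cont_rect T yxx
}.

Definition C2_wave_solution (T : R) (y yt yx : R -> R -> R) : Prop :=
  exists ytt ytx yxt yxx : R -> R -> R,
    C2_rect T y yt yx ytt ytx yxt yxx /\
    forall t x, rect T t x -> ytt t x - yxx t x = 0.

Definition initial_data (y0 y1 : R -> R) (y yt : R -> R -> R) : Prop :=
  forall x, interval 0 (2 * PI) x -> y 0 x = y0 x /\ yt 0 x = y1 x.

Definition final_null (T : R) (y yt : R -> R -> R) : Prop :=
  forall x, interval 0 (2 * PI) x -> y T x = 0 /\ yt T x = 0.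

(* Main.v *)
Require Import Defs.
From Stdlib Require Import Reals Lra.
From Coquelicot Require Import Coquelicot.
Open Scope R_scope.

(** The control prescribes the jump of only one of [y] and [yx] between the two
    ends, and the chosen initial datum lies on a Fourier mode that does not see
    that jump. Let [phi] satisfy
    [phi'' = - k^2 phi], and let [m t] be the integral of [y t x * phi x] for
    [x] in [[0, 2 * PI]]. Differentiating twice under the integral,
    using the equation and integrating by parts twice gives

      [m'' = - k^2 m + boundary term],

    where the boundary term is the increment of [yx * phi - y * phi'] between
    [x = 0] and [x = 2 * PI]. For [phi x = sin (n x)] the factor [phi] vanishes
    at both ends and [phi'] takes equal values there, so the term only involves
    the jump of [y]; for [phi x = cos (n x)] it only involves the jump of [yx].
    In each of the two systems this is the jump that is zero: the control acts
    on the other one. Hence [m] is a free harmonic oscillator and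
    [m'^2 + k^2 m^2] is conserved ([mode_energy_null]). It vanishes at the final
    time, while at time 0 it equals [(n * PI)^2] in the first case and [PI^2] in
    the second one.

    The derivatives at hand are one-sided at the edges of the rectangle, whereas
    the fundamental theorem of calculus and differentiation under the integral
    are about functions on the whole line. A C^1 function on a closed interval
    is therefore continued by its tangents at the end points
    ([extend_is_derive]); this yields the version of the two theorems on a
    closed interval ([is_RInt_deriv_on], [moment_deriv_on]). *)

(** * Continuation of functions beyond a closed interval *)

Definition clamp (a b s : R) : R := Rmax a (Rmin b s).

Lemma clamp_in (a b s : R) : a <= b -> interval a b (clamp a b s).
Proof.
  intros hab; unfold interval, clamp; split; [apply Rmax_l|].
  apply Rmax_lub; [assumption | apply Rmin_l].
Qed.

Lemma clamp_id (a b s : R) : interval a b s -> clamp a b s = s.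
Proof.
  intros [ha hb]; unfold clamp.
  rewrite Rmin_right by assumption; apply Rmax_right; assumption.
Qed.

Lemma clamp_lipschitz (a b s u : R) :
  Rabs (clamp a b s - clamp a b u) <= Rabs (s - u).
Proof.
  unfold clamp, Rmax, Rmin.
  repeat destruct Rle_dec; unfold Rabs; repeat destruct Rcase_abs; lra.
Qed.

(** The nearest point of the interval lies between [s] and any point of it. *)
Lemma clamp_split (a b s0 s : R) : interval a b s0 ->
  Rabs (clamp a b s - s0) + Rabs (s - clamp a b s) = Rabs (s - s0).
Proof.
  intros [ha hb]; unfold clamp, Rmax, Rmin.
  repeat destruct Rle_dec; unfold Rabs; repeat destruct Rcase_abs; lra.
Qed.

Lemma clamp_continuous (a b s : R) : continuous (clamp a b) s.
Proof.
  apply filterlim_locally; intros eps; exists eps; intros u hu.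
  eapply Rle_lt_trans; [apply clamp_lipschitz | exact hu].
Qed.

Lemma continuous_retract {U V : UniformSpace} (D : U -> Prop) (f : U -> V) (r : U -> U) :
  (forall u, D (r u)) -> (forall u, continuous r u) -> continuous_on D f ->
  forall u, continuous (fun v => f (r v)) u.
Proof.
  intros hD hr hf u.
  apply (filterlim_comp _ _ _ r f _ (within D (locally (r u)))); [|apply hf, hD].
  intros P hP; unfold filtermap.
  apply (filter_imp (fun v => D (r v) -> P (r v))); [auto | exact (hr u _ hP)].
Qed.

Lemma clamp_continuous_on (a b : R) (f : R -> R) : a <= b ->
  continuous_on (interval a b) f -> forall s, continuous (fun u => f (clamp a b u)) s.
Proof.
  intros hab hf.
  apply (continuous_retract (interval a b) f (clamp a b)); trivial.
  - intros u; apply clamp_in, hab.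
  - apply clamp_continuous.
Qed.

Lemma clamp_cont_rect (T : R) (f : R -> R -> R) : 0 < T -> cont_rect T f ->
  forall t x, continuity_2d_pt (fun s u => f (clamp 0 T s) (clamp 0 (2 * PI) u)) t x.
Proof.
  intros hT hf t x; apply continuity_2d_pt_filterlim.
  apply (continuous_retract (fun p : R * R => rect T (fst p) (snd p))
           (fun p : R * R => f (fst p) (snd p))
           (fun p => (clamp 0 T (fst p), clamp 0 (2 * PI) (snd p)))); trivial.
  - intros p; split; apply clamp_in; generalize PI_RGT_0; lra.
  - intros p; apply filterlim_locally; intros eps; exists eps; intros q [h1 h2].
    split; (eapply Rle_lt_trans; [apply clamp_lipschitz | assumption]).
Qed.

(** Outside [[a, b]] this is the tangent line at the nearer end point, when
    [f'] is the derivative of [f]. *)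
Definition extend (a b : R) (f f' : R -> R) (s : R) : R :=
  f (clamp a b s) + f' (clamp a b s) * (s - clamp a b s).

Lemma extend_eq (a b : R) (f f' : R -> R) (s : R) :
  interval a b s -> extend a b f f' s = f s.
Proof. intros hs; unfold extend; rewrite (clamp_id a b s hs); ring. Qed.

(** Division-free form of the difference quotient: it also covers [s = s0],
    which occurs when [s] is the clamp of a point outside the interval. *)
Lemma deriv_on_linear_bound (D : R -> Prop) (f f' : R -> R) (s0 eps : R) :
  deriv_on D f f' -> D s0 -> 0 < eps ->
  exists d, 0 < d /\ forall s, D s -> Rabs (s - s0) < d ->
    Rabs (f s - f s0 - f' s0 * (s - s0)) <= eps * Rabs (s - s0).
Proof.
  intros hf hs0 heps.
  destruct (hf s0 hs0 eps heps) as [d [hd Hd]].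
  exists d; split; [exact hd|]; intros s hs hsd.
  destruct (Req_dec s s0) as [->|hne].
  - replace (f s0 - f s0 - f' s0 * (s0 - s0)) with 0 by ring.
    rewrite Rabs_R0; apply Rmult_le_pos; [lra | apply Rabs_pos].
  - replace (f s - f s0 - f' s0 * (s - s0))
      with (((f s - f s0) / (s - s0) - f' s0) * (s - s0)) by (field; lra).
    rewrite Rabs_mult; apply Rmult_le_compat_r; [apply Rabs_pos|].
    apply Rlt_le, (Hd s); split; [split; [exact hs | auto] | exact hsd].
Qed.

(** Away from the interval the continuation is affine. At a point [s0] of it, the
    increment towards [s] goes first to the clamp [c] of [s], where the
    differentiability of [f] inside the interval applies, and then along a
    tangent of slope [f' c], which is close to [f' s0] by continuity; since the
    two lengths add up to [|s - s0|], the errors do too. One argument thus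
    covers interior points and end points. *)
Lemma extend_is_derive (a b : R) (f f' : R -> R) : a < b ->
  deriv_on (interval a b) f f' -> continuous_on (interval a b) f' ->
  forall s, is_derive (extend a b f f') s (f' (clamp a b s)).
Proof.
  intros hab hf hf' s0.
  (* Used for points outside the interval, around which the clamp is constant. *)
  assert (affine : forall c, locally s0 (fun s => clamp a b s = c) ->
            is_derive (extend a b f f') s0 (f' (clamp a b s0))).
  { intros c hc; rewrite (locally_singleton _ _ hc).
    apply (is_derive_ext_loc (fun s => f c + f' c * (s - c))).
    - revert hc; apply filter_imp; intros s hs; unfold extend; rewrite hs; reflexivity.
    - auto_derive; [exact I | ring]. }
  destruct (Rlt_dec s0 a) as [hlt|hge].
  { apply (affine a), (filter_imp (fun s => s < a)); [|exact (open_lt a s0 hlt)].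
    intros s hs; unfold clamp, Rmax, Rmin; repeat destruct Rle_dec; lra. }
  destruct (Rlt_dec b s0) as [hgt|hle].
  { apply (affine b), (filter_imp (fun s => b < s)); [|exact (open_gt b s0 hgt)].
    intros s hs; unfold clamp, Rmax, Rmin; repeat destruct Rle_dec; lra. }
  clear affine.
  assert (hs0 : interval a b s0) by (split; lra).
  rewrite (clamp_id a b s0 hs0).
  apply is_derive_Reals; intros eps heps.
  destruct (deriv_on_linear_bound _ _ _ s0 (eps / 3) hf hs0 ltac:(lra)) as [d1 [hd1 H1]].
  assert (heps3 : 0 < eps / 3) by lra.
  destruct (proj1 (filterlim_locally _ _)
    (clamp_continuous_on a b f' (Rlt_le _ _ hab) hf' s0) (mkposreal _ heps3)) as [d2 H2].
  assert (hd : 0 < Rmin d1 d2) by (apply Rmin_pos; [exact hd1 | apply cond_pos]).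
  exists (mkposreal _ hd); intros h hh hhd; simpl in hhd.
  set (s := s0 + h).
  assert (hsh : s - s0 = h) by (unfold s; ring).
  set (c := clamp a b s).
  pose proof (clamp_split a b s0 s hs0) as hsplit; fold c in hsplit; rewrite hsh in hsplit.
  assert (B1 : Rabs (f c - f s0 - f' s0 * (c - s0)) <= eps / 3 * Rabs (c - s0)).
  { apply H1; [apply clamp_in; lra|].
    pose proof (Rabs_pos (s - c)); pose proof (Rmin_l d1 d2); lra. }
  assert (B2 : Rabs (f' c - f' s0) < eps / 3).
  { specialize (H2 s); simpl in H2.
    rewrite (clamp_id a b s0 hs0) in H2; apply H2.
    change (Rabs (s - s0) < d2); rewrite hsh; pose proof (Rmin_r d1 d2); lra. }
  rewrite (extend_eq _ _ _ _ s0 hs0); unfold extend; fold c.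
  replace ((f c + f' c * (s - c) - f s0) / h - f' s0)
    with (((f c - f s0 - f' s0 * (c - s0)) + (f' c - f' s0) * (s - c)) / h)
    by (rewrite <- hsh; field; rewrite hsh; exact hh).
  rewrite Rabs_div by exact hh.
  assert (hpos : 0 < Rabs h) by (apply Rabs_pos_lt, hh).
  apply (Rmult_lt_reg_r (Rabs h)); [exact hpos|].
  replace (Rabs (f c - f s0 - f' s0 * (c - s0) + (f' c - f' s0) * (s - c)) / Rabs h * Rabs h)
    with (Rabs (f c - f s0 - f' s0 * (c - s0) + (f' c - f' s0) * (s - c))) by (field; lra).
  eapply Rle_lt_trans; [apply Rabs_triang|]; rewrite Rabs_mult.
  assert (Rabs (f' c - f' s0) * Rabs (s - c) <= eps / 3 * Rabs (s - c))
    by (apply Rmult_le_compat_r; [apply Rabs_pos | lra]).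
  assert (0 < eps * Rabs h) by (apply Rmult_lt_0_compat; lra).
  replace (eps / 3 * Rabs (s - c)) with (eps / 3 * Rabs h - eps / 3 * Rabs (c - s0)) in *
    by (rewrite <- hsplit; ring).
  lra.
Qed.

Lemma deriv_on_of_is_derive (D : R -> Prop) (f g g' : R -> R) :
  (forall s, D s -> g s = f s) ->
  (forall s, D s -> is_derive g s (g' s)) -> deriv_on D f g'.
Proof.
  intros heq hg s hs eps heps.
  pose proof (proj2 (derivable_pt_lim_D_in g g' s) (proj1 (is_derive_Reals _ _ _) (hg s hs))) as H.
  destruct (H eps heps) as [d [hd Hd]].
  exists d; split; [exact hd|]; intros u [[hu hne] hus].
  rewrite <- (heq u hu), <- (heq s hs).
  apply Hd; split; [split; [exact I | exact hne] | exact hus].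
Qed.

(** * Calculus on a closed interval and on the rectangle *)

Lemma is_RInt_deriv_on (a b : R) (f f' : R -> R) : a < b ->
  deriv_on (interval a b) f f' -> continuous_on (interval a b) f' ->
  is_RInt f' a b (f b - f a).
Proof.
  intros hab hf hf'.
  rewrite <- (extend_eq a b f f' b), <- (extend_eq a b f f' a) by (split; lra).
  apply (is_RInt_ext (fun s => f' (clamp a b s))).
  { rewrite Rmin_left, Rmax_right by lra; intros s hs.
    rewrite clamp_id; [reflexivity | split; lra]. }
  apply (is_RInt_derive (extend a b f f')).
  - intros s _; apply extend_is_derive; assumption.
  - intros s _; apply clamp_continuous_on; [lra | assumption].
Qed.

Lemma deriv_on_zero_const (a b : R) (f : R -> R) : a < b ->
  deriv_on (interval a b) f (fun _ => 0) -> f a = f b.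
Proof.
  intros hab hf.
  assert (h0 : continuous_on (interval a b) (fun _ : R => 0))
    by (intros s _; apply filterlim_const).
  pose proof (is_RInt_unique _ _ _ _ (is_RInt_deriv_on a b f _ hab hf h0)) as H.
  rewrite RInt_const in H; unfold scal in H; simpl in H; unfold mult in H; simpl in H.
  lra.
Qed.

Lemma continuity_2d_slice (F : R -> R -> R) (t x : R) :
  continuity_2d_pt F t x -> continuous (F t) x.
Proof.
  intros H; apply filterlim_locally; intros eps.
  destruct (H eps) as [d Hd]; exists d; intros u hu.
  apply (Hd t u); [rewrite Rminus_diag, Rabs_R0; apply cond_pos | exact hu].
Qed.

Lemma continuity_2d_snd (phi : R -> R) (t x : R) :
  continuous phi x -> continuity_2d_pt (fun _ u => phi u) t x.
Proof.
  intros H; apply (continuity_1d_2d_pt_comp phi (fun _ u => u)).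
  - apply continuity_pt_filterlim, H.
  - apply continuity_2d_pt_id2.
Qed.

Lemma cont_rect_slice_x (T : R) (f : R -> R -> R) (t : R) :
  interval 0 T t -> cont_rect T f -> continuous_on (interval 0 (2 * PI)) (f t).
Proof.
  intros ht hf x hx P hP.
  destruct (hf (t, x) (conj ht hx) P hP) as [d Hd].
  exists d; intros u hu hD.
  apply (Hd (t, u)); [split; [apply ball_center | exact hu] | split; assumption].
Qed.

Lemma cont_rect_slice_t (T : R) (f : R -> R -> R) (x : R) :
  interval 0 (2 * PI) x -> cont_rect T f -> continuous_on (interval 0 T) (fun t => f t x).
Proof.
  intros hx hf t ht P hP.
  destruct (hf (t, x) (conj ht hx) P hP) as [d Hd].
  exists d; intros u hu hD.
  apply (Hd (u, x)); [split; [exact hu | apply ball_center] | split; assumption].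
Qed.

(** The coefficient of [f t] along the mode [phi]. *)
Definition moment (phi : R -> R) (f : R -> R -> R) (t : R) : R :=
  RInt (fun x => f t x * phi x) 0 (2 * PI).

(** Differentiation under the integral sign up to the ends of [[0, T]]. In [t] the
    integrand is continued by its tangents, and in [x] it is frozen at the end
    points: joint continuity of the [t]-derivative is required on a full
    neighbourhood of every point of the rectangle. *)
Lemma moment_deriv_on (T : R) (phi : R -> R) (f ft : R -> R -> R) :
  0 < T -> (forall x, continuous phi x) ->
  cont_rect T f -> partial_t T f ft -> cont_rect T ft ->
  deriv_on (interval 0 T) (moment phi f) (moment phi ft).
Proof.
  intros hT hphi hf hft hct.
  pose proof PI_RGT_0 as hpi.
  set (cx := clamp 0 (2 * PI)).
  assert (hcx : forall x, interval 0 (2 * PI) (cx x)) by (intros x; apply clamp_in; lra).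
  set (F := fun t x => extend 0 T (fun s => f s (cx x)) (fun s => ft s (cx x)) t).
  assert (hF : forall t x, is_derive (fun s => F s x) t (ft (clamp 0 T t) (cx x))).
  { intros t x.
    apply (extend_is_derive 0 T (fun s => f s (cx x)) (fun s => ft s (cx x)) hT).
    - apply hft, hcx.
    - apply cont_rect_slice_t; [apply hcx | exact hct]. }
  assert (hG : forall t x,
             is_derive (fun s => F s x * phi x) t (ft (clamp 0 T t) (cx x) * phi x)).
  { intros t x.
    replace (ft (clamp 0 T t) (cx x) * phi x)
      with (ft (clamp 0 T t) (cx x) * phi x + F t x * 0) by ring.
    apply is_derive_Reals, (derivable_pt_lim_mult (fun s => F s x) (fun _ => phi x)).
    - apply is_derive_Reals, hF.
    - apply derivable_pt_lim_const. }
  apply (deriv_on_of_is_derive _ _ (fun t => RInt (fun x => F t x * phi x) 0 (2 * PI))).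
  { intros t ht; apply RInt_ext; rewrite Rmin_left, Rmax_right by lra; intros x hx.
    unfold F; rewrite extend_eq by exact ht.
    unfold cx; rewrite clamp_id; [reflexivity | split; lra]. }
  intros t ht.
  replace (moment phi ft t)
    with (RInt (fun x => Derive (fun s => F s x * phi x) t) 0 (2 * PI)).
  2:{ apply RInt_ext; rewrite Rmin_left, Rmax_right by lra; intros x hx.
      transitivity (ft (clamp 0 T t) (cx x) * phi x); [apply is_derive_unique, hG|].
      unfold cx.
      rewrite !clamp_id; [reflexivity | split; lra | exact ht]. }
  apply (is_derive_RInt_param (fun s x => F s x * phi x)).
  - apply filter_forall; intros s x _; eexists; apply hG.
  - intros x _.
    apply (continuity_2d_pt_ext (fun s u => ft (clamp 0 T s) (cx u) * phi u)).
    { intros s u; symmetry; apply is_derive_unique, hG. }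
    apply continuity_2d_pt_mult; [apply clamp_cont_rect; assumption|].
    apply continuity_2d_snd, hphi.
  - apply filter_forall; intros s.
    apply (ex_RInt_continuous (V := R_CompleteNormedModule)); intros x _.
    apply (continuity_2d_slice (fun s u => F s u * phi u)).
    apply continuity_2d_pt_mult; [|apply continuity_2d_snd, hphi].
    unfold F, extend; apply continuity_2d_pt_plus; [|apply continuity_2d_pt_mult].
    + apply clamp_cont_rect; assumption.
    + apply clamp_cont_rect; assumption.
    + apply continuity_2d_pt_minus; [apply continuity_2d_pt_id1|].
      apply (continuity_1d_2d_pt_comp (clamp 0 T) (fun s _ => s)).
      * apply continuity_pt_filterlim, clamp_continuous.
      * apply continuity_2d_pt_id1.
Qed.

(** * Free oscillation of a Fourier mode *)

(** Green's identity: [fxx * phi + k^2 * f * phi] is the derivative of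
    [fx * phi - f * phi'], because [phi'' = - k^2 phi]. *)
Lemma moment_green (T k : R) (phi phi' : R -> R) (f fx fxx : R -> R -> R) (t : R) :
  0 < T ->
  (forall x, is_derive phi x (phi' x)) ->
  (forall x, is_derive phi' x (- k ^ 2 * phi x)) ->
  cont_rect T f -> partial_x T f fx -> partial_x T fx fxx -> cont_rect T fxx ->
  interval 0 T t ->
  fx t (2 * PI) * phi (2 * PI) - f t (2 * PI) * phi' (2 * PI)
    = fx t 0 * phi 0 - f t 0 * phi' 0 ->
  moment phi fxx t = - k ^ 2 * moment phi f t.
Proof.
  intros hT hphi hphi' hf hfx hfxx hcxx ht hbd.
  pose proof PI_RGT_0 as hpi.
  assert (hc : forall x, continuous phi x).
  { intros x; apply (ex_derive_continuous (V := R_NormedModule)); eexists; apply hphi. }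
  assert (hcont : forall g, cont_rect T g ->
            continuous_on (interval 0 (2 * PI)) (fun x => g t x * phi x)).
  { intros g hg x hx.
    apply (filterlim_comp_2 (F := within (interval 0 (2 * PI)) (locally x)) (g t) phi Rmult
             (G := locally (g t x)) (H := locally (phi x))).
    - apply (cont_rect_slice_x T g t ht hg x hx).
    - eapply filterlim_filter_le_1; [apply filter_le_within | apply hc].
    - apply (filterlim_mult (K := R_AbsRing)). }
  assert (hint : forall g, cont_rect T g -> ex_RInt (fun x => g t x * phi x) 0 (2 * PI)).
  { intros g hg.
    apply (ex_RInt_ext (fun x => g t (clamp 0 (2 * PI) x) * phi (clamp 0 (2 * PI) x))).
    { rewrite Rmin_left, Rmax_right by lra; intros x hx.
      rewrite clamp_id; [reflexivity | split; lra]. }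
    apply (ex_RInt_continuous (V := R_CompleteNormedModule)); intros x _.
    apply (clamp_continuous_on 0 (2 * PI) (fun x => g t x * phi x)); [lra | auto]. }
  set (w := fun x => fxx t x * phi x + k ^ 2 * (f t x * phi x)).
  assert (hw : is_RInt w 0 (2 * PI) 0).
  { replace 0 with
      ((fx t (2 * PI) * phi (2 * PI) - f t (2 * PI) * phi' (2 * PI))
       - (fx t 0 * phi 0 - f t 0 * phi' 0)) at 2 by (rewrite hbd; ring).
    apply (is_RInt_deriv_on 0 (2 * PI) (fun x => fx t x * phi x - f t x * phi' x)); [lra| |].
    - intros x hx.
      assert (D1 : D_in phi phi' (interval 0 (2 * PI)) x).
      { apply (deriv_on_of_is_derive (interval 0 (2 * PI)) phi phi phi'); auto. }
      assert (D2 : D_in phi' (fun u => - k ^ 2 * phi u) (interval 0 (2 * PI)) x).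
      { apply (deriv_on_of_is_derive (interval 0 (2 * PI)) phi' phi'); auto. }
      pose proof (Dminus _ _ _ _ _ _ (Dmult _ _ _ _ _ _ (hfxx t ht x hx) D1)
                    (Dmult _ _ _ _ _ _ (hfx t ht x hx) D2)) as D3.
      eapply D_in_ext; [|exact D3]; unfold w; simpl; ring.
    - intros x hx.
      apply (filterlim_comp_2 (F := within (interval 0 (2 * PI)) (locally x))
               (fun x => fxx t x * phi x) (fun x => k ^ 2 * (f t x * phi x)) Rplus
               (G := locally (fxx t x * phi x)) (H := locally (k ^ 2 * (f t x * phi x)))).
      + apply (hcont fxx hcxx x hx).
      + eapply filterlim_comp; [apply (hcont f hf x hx)|].
        apply (filterlim_scal_r (K := R_AbsRing) (V := R_NormedModule) (k ^ 2)).
      + apply (filterlim_plus (V := R_NormedModule)). }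
  assert (hsum : RInt w 0 (2 * PI) = moment phi fxx t + k ^ 2 * moment phi f t).
  { unfold w.
    transitivity (RInt (fun x => fxx t x * phi x) 0 (2 * PI)
                  + RInt (fun x => k ^ 2 * (f t x * phi x)) 0 (2 * PI)).
    - apply (RInt_plus (V := R_CompleteNormedModule)); [apply hint, hcxx|].
      apply (ex_RInt_scal (V := R_CompleteNormedModule)), hint, hf.
    - unfold moment; f_equal.
      apply (RInt_scal (V := R_CompleteNormedModule)), hint, hf. }
  rewrite (is_RInt_unique _ _ _ _ hw) in hsum; lra.
Qed.

(** The moment of [y] along [phi] solves [m'' = - k^2 m], so that [m'^2 + k^2 m^2]
    is constant in time; it is zero at time [T]. *)
Lemma mode_energy_null (T k : R) (phi phi' : R -> R) (y yt yx : R -> R -> R) :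
  0 < T ->
  (forall x, is_derive phi x (phi' x)) ->
  (forall x, is_derive phi' x (- k ^ 2 * phi x)) ->
  C2_wave_solution T y yt yx ->
  (forall t, interval 0 T t ->
     yx t (2 * PI) * phi (2 * PI) - y t (2 * PI) * phi' (2 * PI)
       = yx t 0 * phi 0 - y t 0 * phi' 0) ->
  final_null T y yt ->
  moment phi yt 0 ^ 2 + k ^ 2 * moment phi y 0 ^ 2 = 0.
Proof.
  intros hT hphi hphi' [ytt [ytx [yxt [yxx [[cy [pt ct] [px cx] [ptt ctt] _ _ [pxx cxx]] hw]]]]]
    hbd hnull.
  pose proof PI_RGT_0 as hpi.
  assert (hc : forall x, continuous phi x).
  { intros x; apply (ex_derive_continuous (V := R_NormedModule)); eexists; apply hphi. }
  assert (hode : forall t, interval 0 T t -> moment phi ytt t = - k ^ 2 * moment phi y t).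
  { intros t ht.
    rewrite <- (moment_green T k phi phi' y yx yxx t); auto.
    apply RInt_ext; rewrite Rmin_left, Rmax_right by lra; intros x hx.
    f_equal; apply Rminus_diag_uniq, hw; split; [exact ht | split; lra]. }
  set (E := fun t => moment phi yt t * moment phi yt t
                     + k ^ 2 * (moment phi y t * moment phi y t)).
  assert (hE : deriv_on (interval 0 T) E (fun _ => 0)).
  { intros t ht.
    pose proof (moment_deriv_on T phi y yt hT hc cy pt ct t ht) as D1.
    pose proof (moment_deriv_on T phi yt ytt hT hc ct ptt ctt t ht) as D2.
    pose proof (Dadd _ _ _ _ _ _ (Dmult _ _ _ _ _ _ D2 D2)
                  (Dmult_const _ _ _ _ (k ^ 2) (Dmult _ _ _ _ _ _ D1 D1))) as D3.
    eapply D_in_ext; [|exact D3]; simpl; rewrite (hode t ht); ring. }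
  assert (hT0 : forall g : R -> R -> R,
             (forall x, interval 0 (2 * PI) x -> g T x = 0) -> moment phi g T = 0).
  { intros g hg; unfold moment; rewrite (RInt_ext _ (fun _ => 0)).
    - rewrite RInt_const; unfold scal; simpl; unfold mult; simpl; ring.
    - rewrite Rmin_left, Rmax_right by lra; intros x hx.
      rewrite (hg x) by (split; lra); apply Rmult_0_l. }
  pose proof (deriv_on_zero_const 0 T E hT hE) as H; unfold E in H.
  rewrite (hT0 y), (hT0 yt) in H by (intros x hx; apply (hnull x hx)).
  simpl; lra.
Qed.

(** * The two modes *)

Lemma sin_2n_pi (n : nat) : sin (INR n * (2 * PI)) = 0.
Proof.
  replace (INR n * (2 * PI)) with (0 + 2 * INR n * PI) by ring.
  rewrite sin_period; apply sin_0.
Qed.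

Lemma cos_2n_pi (n : nat) : cos (INR n * (2 * PI)) = 1.
Proof.
  replace (INR n * (2 * PI)) with (0 + 2 * INR n * PI) by ring.
  rewrite cos_period; apply cos_0.
Qed.

(** The difference of squares is [cos (2 n x)], of mean zero. With [s = 1/2] the
    function [g] is [cos^2 (n x)], with [s = -1/2] it is [sin^2 (n x)]. *)
Lemma RInt_half_plus_double_angle (n : nat) (s : R) (g : R -> R) : (0 < n)%nat ->
  (forall x, g x = 1 / 2 + s * (cos (INR n * x) ^ 2 - sin (INR n * x) ^ 2)) ->
  RInt g 0 (2 * PI) = PI.
Proof.
  intros hn hg; apply lt_0_INR in hn.
  apply is_RInt_unique.
  replace PI with
    (minus (2 * PI / 2 + s * (sin (INR n * (2 * PI)) * cos (INR n * (2 * PI)) / INR n))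
           (0 / 2 + s * (sin (INR n * 0) * cos (INR n * 0) / INR n))) at 2.
  2:{ rewrite sin_2n_pi, Rmult_0_r, sin_0; unfold minus, plus, opp; simpl; field; lra. }
  apply (is_RInt_derive (fun x => x / 2 + s * (sin (INR n * x) * cos (INR n * x) / INR n))).
  - intros x _; rewrite hg; auto_derive; [exact I | field; lra].
  - intros x _.
    apply (continuous_ext (fun x => 1 / 2 + s * (cos (INR n * x) ^ 2 - sin (INR n * x) ^ 2))).
    { intros u; symmetry; apply hg. }
    apply (ex_derive_continuous (V := R_NormedModule)); auto_derive; exact I.
Qed.

Theorem mainTheorem12 (n : nat) (hn : (0 < n)%nat) :
  (~ exists (T : R) (h : R -> R),
       0 < T /\ Ck_on 1 (interval 0 T) h /\
       exists y yt yx : R -> R -> R,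
         C2_wave_solution T y yt yx /\
         (forall t, interval 0 T t -> y t 0 = y t (2 * PI)) /\
         (forall t, interval 0 T t -> yx t 0 = yx t (2 * PI) + h t) /\
         initial_data (fun x => sin (INR n * x)) (fun _ => 0) y yt /\
         final_null T y yt)
  /\
  (~ exists (T : R) (h : R -> R),
       0 < T /\ Ck_on 2 (interval 0 T) h /\
       exists y yt yx : R -> R -> R,
         C2_wave_solution T y yt yx /\
         (forall t, interval 0 T t -> y t 0 = y t (2 * PI) + h t) /\
         (forall t, interval 0 T t -> yx t 0 = yx t (2 * PI)) /\
         initial_data (fun _ => 0) (fun x => cos (INR n * x)) y yt /\
         final_null T y yt).
Proof.
  pose proof PI_RGT_0 as hpi.
  pose proof (lt_0_INR n hn) as hn0.
  split.
  - intros [T [h [hT [_ [y [yt [yx [hw [hy [_ [hi hf]]]]]]]]]]].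
    pose proof (mode_energy_null T (INR n) (fun x => sin (INR n * x))
                  (fun x => INR n * cos (INR n * x)) y yt yx hT) as H.
    assert (hz : moment (fun x => sin (INR n * x)) y 0 = PI).
    { unfold moment.
      rewrite (RInt_ext _ (fun x => sin (INR n * x) * sin (INR n * x))).
      - apply (RInt_half_plus_double_angle n (- / 2)); [exact hn|]; intros x.
        pose proof (sin2_cos2 (INR n * x)) as E; unfold Rsqr in E; lra.
      - rewrite Rmin_left, Rmax_right by lra; intros x hx.
        destruct (hi x) as [-> _]; [split; lra | reflexivity]. }
    rewrite hz in H.
    assert (0 < INR n ^ 2 * PI ^ 2) by (apply Rmult_lt_0_compat; apply pow_lt; assumption).
    pose proof (pow2_ge_0 (moment (fun x => sin (INR n * x)) yt 0)).
    enough (moment (fun x => sin (INR n * x)) yt 0 ^ 2 + INR n ^ 2 * PI ^ 2 = 0) by lra.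
    apply H; [| |exact hw| |exact hf].
    + intros x; auto_derive; [exact I | ring].
    + intros x; auto_derive; [exact I | ring].
    + intros t ht; simpl.
      rewrite sin_2n_pi, cos_2n_pi, (Rmult_0_r (INR n)), sin_0, cos_0, (hy t ht); ring.
  - intros [T [h [hT [_ [y [yt [yx [hw [_ [hyx [hi hf]]]]]]]]]]].
    pose proof (mode_energy_null T (INR n) (fun x => cos (INR n * x))
                  (fun x => - INR n * sin (INR n * x)) y yt yx hT) as H.
    assert (hz : moment (fun x => cos (INR n * x)) yt 0 = PI).
    { unfold moment.
      rewrite (RInt_ext _ (fun x => cos (INR n * x) * cos (INR n * x))).
      - apply (RInt_half_plus_double_angle n (/ 2)); [exact hn|]; intros x.
        pose proof (sin2_cos2 (INR n * x)) as E; unfold Rsqr in E; lra.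
      - rewrite Rmin_left, Rmax_right by lra; intros x hx.
        destruct (hi x) as [_ ->]; [split; lra | reflexivity]. }
    rewrite hz in H.
    assert (0 < PI ^ 2) by (apply pow_lt; assumption).
    assert (0 <= INR n ^ 2 * moment (fun x => cos (INR n * x)) y 0 ^ 2)
      by (apply Rmult_le_pos; apply pow2_ge_0).
    enough (PI ^ 2 + INR n ^ 2 * moment (fun x => cos (INR n * x)) y 0 ^ 2 = 0) by lra.
    apply H; [| |exact hw| |exact hf].
    + intros x; auto_derive; [exact I | ring].
    + intros x; auto_derive; [exact I | ring].
    + intros t ht; simpl.
      rewrite sin_2n_pi, cos_2n_pi, (Rmult_0_r (INR n)), sin_0, cos_0, (hyx t ht); ring.
Qed.
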